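(* Let $\mathcal Q$ be a quasivariety in a finite language which has the finite model property and equationally definable principal relative congruences, and assume that its free algebra $\mathbf F$ of countably infinite rank has a finite $\mathcal Q$-simple subalgebra $\mathbf C$. Then $\mathcal Q$ is almost structurally complete if and only if for every finite $\mathcal Q$-subdirectly irreducible algebra $\mathbf S$, either $\mathbf S$ embeds into $\mathbf F$ or $\mathbf S\times\mathbf C$ embeds into $\mathbf F$.
   Context: A quasi-identity is a sentence $q=(\forall\bar x)[\varphi(\bar x)\to\psi(\bar x)]$ with $\varphi$ a finite conjunction of equations and $\psi$ an equation; $q^*=(\forall\bar x)\neg\varphi(\bar x)$. $\mathbf F$ is the free algebra for $\mathcal Q$ over a countably infinite set. A quasi-identity true in $\mathbf F$ is $\mathcal Q$-active if $q^*$ fails in $\mathbf F$; $\mathcal Q$ is almost structurally complete if every $\mathcal Q$-active quasi-identity holds in $\mathcal Q$. A congruence $\alpha$ of $\mathbf A$ is a $\mathcal Q$-congruence if $\mathbf A/\alpha\in\mathcal Q$. A nontrivial algebra is $\mathcal Q$-simple if its only $\mathcal Q$-congruences are the equality and the total relation; a nontrivial $\mathbf S\in\mathcal Q$ is $\mathcal Q$-subdirectly irreducible if equality is completely meet-irreducible in its lattice of $\mathcal Q$-congruences. $\mathcal Q$ has the finite model property if the variety generated by $\mathcal Q$ is generated (as a variety) by the finite members of $\mathcal Q$. $\mathcal Q$ has equationally definable principal relative congruences if there are finitely many equations $s_k(u,v,x,y)\approx t_k(u,v,x,y)$, $k\le n$, such that for all $\mathbf A\in\mathcal Q$ and $a,b,c,d\in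 A$: $(c,d)$ lies in the least $\mathcal Q$-congruence containing $(a,b)$ iff $\mathbf A\models\bigwedge_{k\le n}s_k(c,d,a,b)\approx t_k(c,d,a,b)$. *)

(* Defs.v *)
From mathcomp Require Import all_boot.
From mathcomp Require Import boolp classical_sets functions cardinality.

Set Implicit Arguments.
Unset Strict Implicit.
Unset Printing Implicit Defensive.

Local Open Scope classical_set_scope.

Record signature := Signature {
  symb : Type;
  arity : symb -> nat }.

(* Carriers are nonempty, as usual in universal algebra; [inhabited] is a
   proposition, so no point is distinguished. *)
Record algebra (L : signature) := Algebra {
  carrier :> Type;
  op : forall f : symb L, ('I_(arity f) -> carrier) -> carrier;
  algebra_inhabited : inhabited carrier }.
Arguments op {L} a f.

Inductive term (L : signature) (V : Type) : Type :=
  | Var of V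
  | App (f : symb L) of ('I_(arity f) -> term L V).
Arguments Var {L V}.
Arguments App {L V} f.

Fixpoint eval (L : signature) (A : algebra L) (V : Type) (h : V -> A)
    (t : term L V) : A :=
  match t with
  | Var v => h v
  | App f ts => op A f (fun i => eval h (ts i))
  end.

Definition equation (L : signature) (V : Type) : Type := (term L V * term L V)%type.

Definition solves (L : signature) (A : algebra L) (V : Type) (h : V -> A)
  (e : equation L V) : Prop := eval h e.1 = eval h e.2.

Definition solves_all (L : signature) (A : algebra L) (V : Type) (h : V -> A)
  (phi : seq (equation L V)) : Prop := foldr and True (map (solves h) phi).

Definition satisfies (L : signature) (A : algebra L) (e : equation L nat) :=
  forall h : nat -> A, solves h e.

(* Variables are indexed by [nat]; since carriers are nonempty, quantifying over
   all of them is the same as quantifying over those which occur. *)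
Record quasi_identity (L : signature) := QuasiIdentity {
  premises : seq (equation L nat);
  conclusion : equation L nat }.

Definition qsatisfies (L : signature) (A : algebra L) (q : quasi_identity L) :=
  forall h : nat -> A, solves_all h (premises q) -> solves h (conclusion q).

(* Truth in [A] of q^* = (forall x) ~ phi, where phi is the premise of [q]. *)
Definition satisfies_star (L : signature) (A : algebra L) (q : quasi_identity L) :=
  forall h : nat -> A, ~ solves_all h (premises q).

(* Classes of algebras have type [algebra L -> Prop] rather than [set (algebra L)]:
   the latter would force the universe of carriers below that of term algebras. *)
Definition quasivariety (L : signature) (Q : algebra L -> Prop) : Prop :=
  exists Sigma : quasi_identity L -> Prop,
    forall A, Q A <-> (forall q, Sigma q -> qsatisfies A q).

Definition variety (L : signature) (V : algebra L -> Prop) : Prop :=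
  exists E : equation L nat -> Prop,
    forall A, V A <-> (forall e, E e -> satisfies A e).

Definition generated_variety (L : signature) (K : algebra L -> Prop)
    (A : algebra L) : Prop :=
  forall V : algebra L -> Prop, variety V -> (forall B, K B -> V B) -> V A.

Definition finite_algebra (L : signature) (A : algebra L) : Prop :=
  finite_set [set: A].

Definition finite_model_property (L : signature) (Q : algebra L -> Prop) : Prop :=
  forall A, generated_variety Q A <->
    generated_variety (fun B => Q B /\ finite_algebra B) A.

Definition nontrivial (L : signature) (A : algebra L) : Prop :=
  exists a b : A, a <> b.

Definition is_hom (L : signature) (A B : algebra L) (h : A -> B) : Prop :=
  forall (f : symb L) (xs : 'I_(arity f) -> A),
    h (op A f xs) = op B f (fun i => h (xs i)).

Definition embeds (L : signature) (A B : algebra L) : Prop :=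
  exists h : A -> B, is_hom h /\ injective h.

(* [F] is free for [Q] over the countably infinite family [x]. *)
Definition free_algebra (L : signature) (Q : algebra L -> Prop) (F : algebra L)
    (x : nat -> F) : Prop :=
  Q F /\ forall (A : algebra L) (a : nat -> A), Q A ->
    exists! h : F -> A, is_hom h /\ (forall n, h (x n) = a n).

Definition prod_op (L : signature) (A B : algebra L) (f : symb L)
    (xs : 'I_(arity f) -> A * B) : A * B :=
  (op A f (fun i => (xs i).1), op B f (fun i => (xs i).2)).

Lemma prod_inhabited (L : signature) (A B : algebra L) : inhabited (A * B).
Proof. by case: (algebra_inhabited A) => a; case: (algebra_inhabited B) => b. Qed.

Definition prod_algebra (L : signature) (A B : algebra L) : algebra L :=
  Algebra (@prod_op L A B) (prod_inhabited A B).

Record subuniverse (L : signature) (A : algebra L) (C : set A) : Prop :=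
  Subuniverse {
    subuniverse_nonempty : C !=set0;
    subuniverse_op : forall (f : symb L) (xs : 'I_(arity f) -> A),
      (forall i, C (xs i)) -> C (op A f xs) }.

Section Subalgebra.
Variables (L : signature) (A : algebra L) (C : set A) (hC : subuniverse C).

Definition subalgebra_op (f : symb L) (xs : 'I_(arity f) -> {a : A | C a}) :
    {a : A | C a} :=
  exist C (op A f (fun i => sval (xs i)))
    (subuniverse_op hC (fun i => svalP (xs i))).

Lemma subalgebra_inhabited : inhabited {a : A | C a}.
Proof. by case: (subuniverse_nonempty hC) => a Ca; exists; exists a. Qed.

Definition subalgebra : algebra L :=
  Algebra subalgebra_op subalgebra_inhabited.

End Subalgebra.

(* A congruence is a set of pairs, ordered by inclusion; the equality congruence
   is [diagonal] and the total one is [setT]. *)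
Record congruence (L : signature) (A : algebra L) (theta : set (A * A)) : Prop :=
  Congruence {
    cong_refl : forall a, theta (a, a);
    cong_sym : forall a b, theta (a, b) -> theta (b, a);
    cong_trans : forall a b c, theta (a, b) -> theta (b, c) -> theta (a, c);
    cong_op : forall (f : symb L) (xs ys : 'I_(arity f) -> A),
      (forall i, theta (xs i, ys i)) -> theta (op A f xs, op A f ys) }.

(* The elements of the quotient are the classes of [theta], and its operations are
   computed on chosen representatives. It is defined for every [theta], but is
   meaningful only when [theta] is a congruence; see [quotient_pi_hom] and
   [quotient_piP]. *)
Section Quotient.
Variables (L : signature) (A : algebra L) (theta : set (A * A)).

Definition quotient_carrier : Type :=
  {P : A -> Prop | exists a, P = fun b => theta (a, b)}.

Definition quotient_pi (a : A) : quotient_carrier :=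
  exist _ (fun b => theta (a, b)) (ex_intro _ a erefl).

Definition quotient_repr (u : quotient_carrier) : A := sval (cid (svalP u)).

Definition quotient_op (f : symb L) (us : 'I_(arity f) -> quotient_carrier) :
    quotient_carrier :=
  quotient_pi (op A f (fun i => quotient_repr (us i))).

Lemma quotient_inhabited : inhabited quotient_carrier.
Proof. by case: (algebra_inhabited A) => a; exists; exact: quotient_pi a. Qed.

Definition quotient : algebra L := Algebra quotient_op quotient_inhabited.

Lemma quotient_reprK (u : quotient) : quotient_pi (quotient_repr u) = u.
Proof.
apply: eq_sig_hprop => [P|/=]; first exact: Prop_irrelevance.
by rewrite /quotient_repr; case: cid.
Qed.

Lemma quotient_piP (a b : A) : congruence theta ->
  quotient_pi a = quotient_pi b <-> theta (a, b).
Proof.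
move=> ct; split=> [ab|ab].
  have /= -> := congr1 (fun u => sval u b) ab.
  exact: (cong_refl ct b).
apply: eq_sig_hprop => [P|/=]; first exact: Prop_irrelevance.
apply/funext => c; apply/propext; split => h.
  exact: (cong_trans ct (cong_sym ct ab) h).
exact: (cong_trans ct ab h).
Qed.

Lemma quotient_pi_hom : congruence theta -> is_hom (quotient_pi : A -> quotient).
Proof.
move=> ct f xs; apply/quotient_piP => //; apply: cong_op => // i.
by apply/quotient_piP => //; rewrite quotient_reprK.
Qed.

End Quotient.

Section RelativeCongruences.
Variables (L : signature) (Q : algebra L -> Prop).

Definition Qcongruence (A : algebra L) (theta : set (A * A)) : Prop :=
  congruence theta /\ Q (quotient theta).

Definition Qsimple (A : algebra L) : Prop :=
  nontrivial A /\
  forall theta : set (A * A),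
    Qcongruence theta <-> theta = diagonal \/ theta = setT.

(* [m] is the greatest lower bound of [X] in the set [P], ordered by inclusion. *)
Definition is_meet (T : Type) (P X : set (set T)) (m : set T) : Prop :=
  [/\ P m, forall a, X a -> m `<=` a &
      forall b, P b -> (forall a, X a -> b `<=` a) -> b `<=` m].

Definition completely_meet_irreducible (T : Type) (P : set (set T)) (m : set T) :=
  P m /\ forall X : set (set T), X `<=` P -> is_meet P X m -> X m.

Definition Qsubdirectly_irreducible (S : algebra L) : Prop :=
  [/\ nontrivial S, Q S &
      completely_meet_irreducible (@Qcongruence S) diagonal].

Definition principal_Qcongruence (A : algebra L) (a b : A) : set (A * A) :=
  smallest (@Qcongruence A) [set (a, b)].

Definition env4 (T : Type) (u v x y : T) (i : 'I_4) : T :=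
  nth u [:: u; v; x; y] i.

Definition has_EDPRC : Prop :=
  exists eqs : seq (equation L 'I_4),
  forall (A : algebra L) (a b c d : A), Q A ->
    principal_Qcongruence a b (c, d) <-> solves_all (env4 c d a b) eqs.

Definition active (F : algebra L) (q : quasi_identity L) : Prop :=
  qsatisfies F q /\ ~ satisfies_star F q.

(* [F] is meant to be free for [Q] of countably infinite rank. *)
Definition almost_structurally_complete (F : algebra L) : Prop :=
  forall q, active F q -> forall A, Q A -> qsatisfies A q.

End RelativeCongruences.

(* Main.v *)
Require Import Defs.
From Stdlib Require List.
From mathcomp Require Import all_boot.
From mathcomp Require Import boolp classical_sets functions cardinality.

Set Implicit Arguments.
Unset Strict Implicit.
Unset Printing Implicit Defensive.

Local Open Scope classical_set_scope.

(** Relative congruences of [A] are handled as kernels of homomorphisms from [A]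
to members of [Q].

If [F] has the property of almost structural completeness and [S] has monolith
generated by [(c, d)], the diagram of [S] together with the conclusion [c = d]
is a quasi-identity failing in [S]: either it fails in [F], which gives an
embedding of [S], or there is no homomorphism from [S] to [F].  In the latter
case the same argument applied to [S * C], which does map to [F] through [C],
gives a homomorphism from [S * C] to [F] separating [(c, e)] from [(d, e)].  By
EDPRC, membership in principal relative congruences of a product is
componentwise, and this forces the homomorphism to be injective.

Conversely, iterating EDPRC turns a quasi-identity into a finite set of
identities valid in the same members of [Q]; hence, by the finite model
property, a quasi-identity which fails in [Q] fails in some finite member of
[Q].  One of least cardinality is relatively subdirectly irreducible, so it or
its product with [C] embeds into [F]; if the quasi-identity is active, its
premises are solvable in [F], hence in [C], and it fails in [F] in both cases. *)

(** * Finiteness by enumerations, possibly with repetitions *)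

Lemma finite_enumeration (T : Type) : finite_set [set: T] ->
  exists n (e : 'I_n -> T), forall t, exists i, e i = t.
Proof.
case=> n /card_set_bijP [f [fn finj fsurj]].
exists n.
have /choice [e eP] : forall i : 'I_n, exists t, f t = i.
  by move=> i; have [t _ <-] := fsurj i (ltn_ord i); exists t.
exists e => t; exists (Ordinal (fn t I)).
by apply: finj; rewrite ?inE // eP.
Qed.

Lemma enumeration_finite (T : Type) (n : nat) (e : 'I_n -> T) :
  (forall t, exists i, e i = t) -> finite_set [set: T].
Proof.
move=> esurj; rewrite (_ : [set: T] = [set e i | i in [set: 'I_n]]).
  by apply: finite_image; exact: finite_finset.
by apply/seteqP; split=> // t _; have [i <-] := esurj t; exists i.
Qed.

(** * Homomorphisms, solutions of equations, kernels *)

Section Homomorphisms.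
Context {L : signature}.
Implicit Types A B D : algebra L.

Lemma comp_hom A B D (g : B -> D) (h : A -> B) :
  is_hom g -> is_hom h -> is_hom (g \o h).
Proof. by move=> gh hh f xs; rewrite /= hh gh. Qed.

Lemma id_hom A : is_hom (@id A).
Proof. by []. Qed.

Lemma fst_hom A B : @is_hom L (prod_algebra A B) A fst.
Proof. by []. Qed.

Lemma snd_hom A B : @is_hom L (prod_algebra A B) B snd.
Proof. by []. Qed.

Lemma sval_hom A (X : set A) (hX : subuniverse X) :
  @is_hom L (subalgebra hX) A sval.
Proof. by []. Qed.

Lemma eval_hom A B (g : A -> B) (V : Type) (h : V -> A) (t : term L V) :
  is_hom g -> eval (g \o h) t = g (eval h t).
Proof.
move=> gh; elim: t => //= f ts IH; rewrite gh; congr op.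
by apply/funext.
Qed.

Lemma solves_hom A B (g : A -> B) (V : Type) (h : V -> A) (e : equation L V) :
  is_hom g -> solves h e -> solves (g \o h) e.
Proof. by move=> gh he; rewrite /solves !eval_hom // he. Qed.

Lemma solves_all_hom A B (g : A -> B) (V : Type) (h : V -> A) s :
  is_hom g -> solves_all h s -> solves_all (g \o h) s.
Proof.
by move=> gh; elim: s => //= e s IH [he hs]; split; [exact: solves_hom | exact: IH].
Qed.

Lemma solves_injective_hom A B (g : A -> B) (V : Type) (h : V -> A) e :
  is_hom g -> injective g -> solves (g \o h) e -> solves h e.
Proof. by move=> gh ginj; rewrite /solves !eval_hom // => /ginj. Qed.

Lemma solves_all_In A (V : Type) (h : V -> A) s :
  solves_all h s <-> forall e, List.In e s -> solves h e.
Proof.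
rewrite /solves_all; elim: s => //= e s ->; split=> [[he hs] _ [<-|/hs]|hs] //.
by split=> [|e' se]; apply: hs; [left | right].
Qed.

Lemma solves_all_cat A (V : Type) (h : V -> A) s1 s2 :
  solves_all h (s1 ++ s2) <-> solves_all h s1 /\ solves_all h s2.
Proof.
rewrite /solves_all map_cat; elim: s1 => [|e s IH] /=; first by tauto.
by rewrite IH; tauto.
Qed.

Lemma solves_all_map A (V : Type) (h : V -> A) (I : eqType) (s : seq I) F :
  solves_all h [seq F i | i <- s] <-> forall i, i \in s -> solves h (F i).
Proof.
rewrite /solves_all; elim: s => //= j s ->; split=> [[hj hs] i|hs].
  by rewrite inE => /orP[/eqP->|/hs].
by split=> [|i si]; apply: hs; rewrite inE ?eqxx // si orbT.
Qed.

Lemma solves_all_flatten A (V : Type) (h : V -> A) (I : eqType) (s : seq I) F :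
  solves_all h (flatten [seq F i | i <- s]) <->
  forall i, i \in s -> solves_all h (F i).
Proof.
elim: s => //= j s IH; rewrite solves_all_cat IH; split=> [[hj hs] i|hs].
  by rewrite inE => /orP[/eqP->|/hs].
by split=> [|i si]; apply: hs; rewrite inE ?eqxx // si orbT.
Qed.

Lemma solves_all_prod A B (V : Type) (h : V -> prod_algebra A B) s :
  solves_all (fst \o h) s -> solves_all (snd \o h) s -> solves_all h s.
Proof.
elim: s => //= e s IH [h1 hs1] [h2 hs2]; split; last exact: IH.
have E1 t := @eval_hom (prod_algebra A B) A fst V h t (@fst_hom A B).
have E2 t := @eval_hom (prod_algebra A B) B snd V h t (@snd_hom A B).
apply: injective_projections.
  exact: (etrans (esym (E1 e.1)) (etrans h1 (E1 e.2))).
exact: (etrans (esym (E2 e.1)) (etrans h2 (E2 e.2))).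
Qed.

Fixpoint subst (V W : Type) (r : V -> term L W) (t : term L V) : term L W :=
  match t with
  | Var v => r v
  | App f ts => App f (fun i => subst r (ts i))
  end.

Lemma eval_subst A (V W : Type) (h : W -> A) (r : V -> term L W) t :
  eval h (subst r t) = eval (eval h \o r) t.
Proof. by elim: t => //= f ts IH; congr op; apply/funext. Qed.

Lemma solves_all_subst A (V W : Type) (h : W -> A) (r : V -> term L W) s :
  solves_all h [seq (subst r e.1, subst r e.2) | e <- s] <->
  solves_all (eval h \o r) s.
Proof.
rewrite /solves_all; elim: s => //= e s ->.
by rewrite /solves /= !eval_subst.
Qed.

Lemma comp_env4 (T U : Type) (g : T -> U) a b c d :
  g \o env4 a b c d = env4 (g a) (g b) (g c) (g d).
Proof. by apply/funext => -[[|[|[|[|i]]]] //= ?]. Qed.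

Lemma env4_pair (T U : Type) (a b c d : T * U) :
  fst \o env4 a b c d = env4 a.1 b.1 c.1 d.1 /\
  snd \o env4 a b c d = env4 a.2 b.2 c.2 d.2.
Proof. by rewrite !comp_env4. Qed.

Definition kernel A B (g : A -> B) : set (A * A) := [set p | g p.1 = g p.2].

Lemma kernel_congruence A B (g : A -> B) : is_hom g -> congruence (kernel g).
Proof.
move=> gh; split; rewrite /kernel //=; first by move=> a b c ->.
by move=> f xs ys xy; rewrite !gh; congr op; apply/funext.
Qed.

Lemma quotient_repr_rel A (theta : set (A * A)) (a : A) : congruence theta ->
  theta (a, quotient_repr (quotient_pi theta a)).
Proof. by move=> ct; apply/quotient_piP => //; rewrite quotient_reprK. Qed.

(** Choosing representatives need not be a homomorphism, but [g] takes one value on each class, so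
    the choice disappears after composing with [g]. *)
Lemma quotient_lift_hom A B (theta : set (A * A)) (g : A -> B) :
  congruence theta -> is_hom g -> theta `<=` kernel g ->
  is_hom (g \o (@quotient_repr _ _ theta) : quotient theta -> B).
Proof.
move=> ct gh sub f us.
have /= := sub _ (quotient_repr_rel (op A f (fun i => quotient_repr (us i))) ct).
by rewrite /kernel /= => <-; rewrite gh.
Qed.

(** This lets the quotient by [kernel g] stand in for the image of [g]. *)
Lemma solves_kernel A B (g : A -> B) (V : Type) (h : V -> A) e : is_hom g ->
  solves (g \o h) e <-> solves (quotient_pi (kernel g) \o h : V -> quotient (kernel g)) e.
Proof.
move=> gh; have ck := kernel_congruence gh.
rewrite /solves !(eval_hom _ _ gh) !(eval_hom _ _ (quotient_pi_hom ck)).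
by rewrite quotient_piP.
Qed.

Lemma solves_all_kernel A B (g : A -> B) (V : Type) (h : V -> A) s : is_hom g ->
  solves_all (g \o h) s <->
  solves_all (quotient_pi (kernel g) \o h : V -> quotient (kernel g)) s.
Proof.
move=> gh; rewrite !solves_all_In; split=> H e se.
  exact: (solves_kernel h e gh).1 (H e se).
exact: (solves_kernel h e gh).2 (H e se).
Qed.

End Homomorphisms.

(** * Relative congruences and monoliths *)

Section Quasivariety.
Context {L : signature} {Q : algebra L -> Prop}.
Hypothesis HQ : quasivariety Q.
Implicit Types A B D : algebra L.

(** A homomorphism separating the two sides of a failed conclusion keeps the premises true, so it
    would carry the failure into a member of [Q]. This replaces closure under subalgebras and
    arbitrary products. *)
Lemma separated_mem A :
  (forall a b : A, a <> b ->
     exists B (g : A -> B), [/\ Q B, is_hom g & g a <> g b]) -> Q A.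
Proof.
case: HQ => Sigma SigmaP sep; apply/SigmaP => q Sq h hprem.
apply: contrapT => /sep [B [g [QB gh]]]; apply.
rewrite -!eval_hom //; have /SigmaP /(_ q Sq (g \o h)) := QB.
by apply; exact: solves_all_hom.
Qed.

Lemma injective_mem A B (g : A -> B) : Q B -> is_hom g -> injective g -> Q A.
Proof.
by move=> QB gh ginj; apply: separated_mem => a b ab; exists B, g; split=> // /ginj.
Qed.

Lemma prod_mem A B : Q A -> Q B -> Q (prod_algebra A B).
Proof.
move=> QA QB; apply: separated_mem => a b ab.
have [e1|n1] := pselect (a.1 = b.1); last by exists A, fst; split.
exists B, snd; split=> // e2; apply: ab.
exact: injective_projections.
Qed.

Lemma separated_Qcongruence A (theta : set (A * A)) : congruence theta ->
  (forall a b, ~ theta (a, b) ->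
     exists B (g : A -> B),
       [/\ Q B, is_hom g, theta `<=` kernel g & g a <> g b]) ->
  Qcongruence Q theta.
Proof.
move=> ct sep; split=> //; apply: separated_mem => u v uv.
have [|B [g [QB gh sub guv]]] := sep (quotient_repr u) (quotient_repr v).
  by move/quotient_piP => /(_ ct); rewrite !quotient_reprK.
exists B, (g \o (@quotient_repr _ _ theta)); split=> //.
exact: quotient_lift_hom.
Qed.

Lemma kernel_Qcongruence A B (g : A -> B) :
  Q B -> is_hom g -> Qcongruence Q (kernel g).
Proof.
move=> QB gh; apply: separated_Qcongruence; first exact: kernel_congruence.
by move=> a b nab; exists B, g; split.
Qed.

Lemma kernel_quotient_pi A (theta : set (A * A)) :
  congruence theta -> kernel (quotient_pi theta : A -> quotient theta) = theta.
Proof.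
move=> ct; apply/seteqP; split=> -[a b] /=; rewrite /kernel /=.
  by move/quotient_piP; apply.
by move=> ab; apply/quotient_piP.
Qed.

(** Membership of [(c, d)] in the principal relative congruence of [(a, b)], phrased through
    homomorphisms; see [principal_QcongruenceP]. *)
Definition forces A (a b c d : A) : Prop :=
  forall B (g : A -> B), Q B -> is_hom g -> g a = g b -> g c = g d.

Lemma principal_QcongruenceP A (a b c d : A) :
  principal_Qcongruence Q a b (c, d) <-> forces a b c d.
Proof.
split=> [H B g QB gh gab|H theta [[ct Qt] tab]].
  by apply: (H (kernel g)); split; [exact: kernel_Qcongruence | move=> _ ->].
apply/quotient_piP => //; apply: (H _ _ Qt (quotient_pi_hom ct)).
by apply/quotient_piP => //; exact: tab.
Qed.

Lemma Qsimple_forces A (a b c d : A) :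
  Qsimple Q A -> a <> b -> forces a b c d.
Proof.
move=> [_ simpleA] ab B g QB gh gab.
have [kd|kt] := (simpleA (kernel g)).1 (kernel_Qcongruence QB gh).
  by have : kernel g (a, b) by []; rewrite kd.
by have : kernel g (c, d) by rewrite kt.
Qed.

Lemma Qsubdirectly_irreducible_monolith A : Qsubdirectly_irreducible Q A ->
  exists c d : A, c <> d /\ forall a b, a <> b -> forces a b c d.
Proof.
move=> [_ _ [Qdiag irr]].
pose X := [set theta | @Qcongruence L Q A theta /\ theta <> diagonal].
(* Without such a [b], [diagonal] would be the meet of [X], hence by irreducibility a member of
   [X]. *)
have [b [Qb bX bd]] : exists b, [/\ Qcongruence Q b,
    forall a, X a -> b `<=` a & ~ b `<=` diagonal].
  apply: contrapT => nex; have [] : X diagonal; last by [].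
  apply: irr => [theta [] //|]; split=> // [theta [[ct _] _]|b Qb bX].
    by move=> [u v] uv; rewrite (_ : u = v) //; exact: (cong_refl ct).
  by apply: contrapT => bd; apply: nex; exists b.
have [[c d] bcd ncd] : exists2 p, b p & p.1 <> p.2.
  apply: contrapT => nex; apply: bd => p bp; apply: contrapT => np.
  by apply: nex; exists p.
exists c, d; split=> // u v uv B g QB gh guv.
suff Xg : X (kernel g) by have := bX _ Xg _ bcd.
split; first exact: kernel_Qcongruence.
by move=> kd; have : kernel g (u, v) by []; rewrite kd.
Qed.

Lemma monolith_Qsubdirectly_irreducible A (c d : A) : Q A -> c <> d ->
  (forall a b, a <> b -> forces a b c d) -> Qsubdirectly_irreducible Q A.
Proof.
move=> QA cd mono.
have diagE : diagonal = kernel (@id A) by [].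
have below theta : @Qcongruence L Q A theta -> theta <> diagonal -> theta (c, d).
  move=> [ct Qt] nd; apply: contrapT => ncd; apply: nd; apply/seteqP; split.
    move=> [a b] /= ab; apply: contrapT => nab; apply: ncd.
    apply/quotient_piP => //; apply: (mono a b nab _ _ Qt (quotient_pi_hom ct)).
    exact/quotient_piP.
  by move=> [a b] ab; rewrite (_ : a = b) //; exact: (cong_refl ct).
split=> //; first by exists c, d.
split; first by rewrite diagE; apply: kernel_Qcongruence.
move=> X XQ [_ _ glb]; apply: contrapT => nX.
(* The intersection of [X] is a relative congruence, as the quotients by members of [X] separate its
   classes. It contains [(c, d)], so it cannot lie below [diagonal]. *)
apply: cd; apply: (glb (\bigcap_(theta in X) theta) _ _ (c, d)).
- apply: separated_Qcongruence.
    split.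
    + by move=> a theta /XQ [ct _]; exact: (cong_refl ct).
    + by move=> a b H theta Xt; have [ct _] := XQ _ Xt; exact: cong_sym (H _ Xt).
    + move=> a b e H K theta Xt; have [ct _] := XQ _ Xt.
      exact: (cong_trans ct (H _ Xt) (K _ Xt)).
    + move=> f xs ys H theta Xt; have [ct _] := XQ _ Xt.
      by apply: (cong_op ct) => i; exact: H.
  move=> a b /existsNP [theta /not_implyP [Xt nab]]; have [ct Qt] := XQ _ Xt.
  exists (quotient theta), (quotient_pi theta); split=> //.
  + exact: quotient_pi_hom.
  + by rewrite kernel_quotient_pi // => p; apply.
  + by move/quotient_piP => /(_ ct).
- by move=> a Xa p; apply.
- by move=> theta Xt; apply: below; [exact: XQ | move=> E; apply: nX; rewrite -E].
Qed.

(** * Consequences of EDPRC *)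

Hypothesis HE : has_EDPRC Q.

(** EDPRC makes forcing a matter of solving fixed equations, and equations are solved in a product
    as soon as they are solved in both coordinates. *)
Lemma forces_prod A B (a b c d : prod_algebra A B) : Q A -> Q B ->
  forces a.1 b.1 c.1 d.1 -> forces a.2 b.2 c.2 d.2 -> forces a b c d.
Proof.
case: HE => eqs eqsP QA QB.
move=> /principal_QcongruenceP /eqsP -/(_ QA) H1.
move=> /principal_QcongruenceP /eqsP -/(_ QB) H2.
apply/principal_QcongruenceP/eqsP; first exact: prod_mem.
have [E1 E2] := env4_pair c d a b.
by apply: solves_all_prod; rewrite ?E1 ?E2.
Qed.

(** Induction on the premises: a premise [e] is removed by replacing the conclusion [psi] with the
    EDPRC equations stating that [e] forces [psi], to be derived from the remaining premises. *)
Lemma quasi_identity_as_identities (phi : seq (equation L nat))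
    (psi : equation L nat) :
  exists E : seq (equation L nat), forall A (h : nat -> A), Q A ->
    solves_all h E <->
    forall B (g : A -> B), Q B -> is_hom g ->
      solves_all (g \o h) phi -> solves (g \o h) psi.
Proof.
case: HE => eqs eqsP; elim: phi psi => [|e phi IH] psi.
  exists [:: psi] => A h QA; split=> [[hpsi _] B g QB gh _|H].
    exact: solves_hom.
  by split=> //; apply: (H A id QA (@id_hom _ A)).
(* EDPRC yields several equations, so the induction hypothesis is first extended to lists of
   conclusions. *)
have IHs Psi : exists E : seq (equation L nat), forall A (h : nat -> A), Q A ->
    solves_all h E <->
    forall B (g : A -> B), Q B -> is_hom g ->
      solves_all (g \o h) phi -> solves_all (g \o h) Psi.
  elim: Psi => [|p Psi [E EP]]; first by exists [::].
  have [E1 E1P] := IH p; exists (E1 ++ E) => A h QA.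
  rewrite solves_all_cat E1P // EP //; split=> [[H1 H2] B g QB gh hphi|H].
    by split; [exact: H1 | exact: H2].
  by split=> B g QB gh hphi; have [] := H B g QB gh hphi.
pose r := env4 psi.1 psi.2 e.1 e.2.
have [E EP] := IHs [seq (subst r p.1, subst r p.2) | p <- eqs].
exists E => A h QA; rewrite EP //.
have key B (g : A -> B) : Q B ->
    solves_all (g \o h) [seq (subst r p.1, subst r p.2) | p <- eqs] <->
    forces (eval (g \o h) e.1) (eval (g \o h) e.2)
           (eval (g \o h) psi.1) (eval (g \o h) psi.2).
  by move=> QB; rewrite solves_all_subst comp_env4 -eqsP // principal_QcongruenceP.
split=> [H B g QB gh [he hphi]|H B g QB gh hphi].
  exact: ((key B g QB).1 (H B g QB gh hphi) B id QB (@id_hom _ B) he).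
apply/key => // D k QD kh hk.
have kgh := comp_hom kh gh.
have kgE t : k (eval (g \o h) t) = eval ((k \o g) \o h) t by rewrite -eval_hom.
rewrite !kgE; apply: (H D (k \o g) QD kgh); split; first by rewrite /solves -!kgE.
exact: (solves_all_hom kh hphi).
Qed.

(** * Finite countermodels *)

Hypothesis HFMP : finite_model_property Q.

Lemma finite_countermodel (q : quasi_identity L) A : Q A -> ~ qsatisfies A q ->
  exists B, [/\ Q B, finite_algebra B & ~ qsatisfies B q].
Proof.
move=> QA nA; apply: contrapT => nex; apply: nA => h hprem.
have [E EP] := quasi_identity_as_identities (premises q) (conclusion q).
(* If no finite member of [Q] refutes [q], they all lie in the variety [V]; the finite model
   property then puts [A] in [V]. *)
pose V (D : algebra L) := forall e, List.In e E -> satisfies D e.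
have VE D : V D <-> forall k : nat -> D, solves_all k E.
  split=> [VD k|VD e eE k]; first by apply/solves_all_In => e eE; exact: VD.
  by move/solves_all_In: (VD k); exact.
have VA : V A.
  apply: ((HFMP A).1 _ V); first by move=> W _; exact.
    by exists (fun e => List.In e E).
  move=> D [QD fD]; apply/VE => k; apply/EP => // B g QB gh gprem.
  (* [B] may be infinite, but the quotient of the finite [D] by [kernel g] is finite and refutes [q]
     as well. *)
  apply: contrapT => nconc; apply: nex; exists (quotient (kernel g)).
  have [ct Qt] := kernel_Qcongruence QB gh; split=> //.
    rewrite /finite_algebra (_ : setT = range (quotient_pi (kernel g))).
      exact: finite_image.
    by apply/seteqP; split=> // u _; exists (quotient_repr u); rewrite ?quotient_reprK.
  by move=> sat; apply: nconc; apply/(solves_kernel _ _ gh)/sat/(solves_all_kernel _ _ gh).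
exact: ((EP A h QA).1 ((VE A).1 VA h) A id QA (@id_hom _ A) hprem).
Qed.

Lemma noninjective_quotient_enumeration A B (n : nat) (e : 'I_n.+1 -> A) (g : A -> B) (a b : A) :
  (forall t, exists i, e i = t) -> is_hom g -> a <> b -> g a = g b ->
  exists e' : 'I_n -> quotient (kernel g), forall t, exists i, e' i = t.
Proof.
move=> esurj gh ab gab; have [i ia] := esurj a; have [j jb] := esurj b.
have ij : i != j by apply/eqP => E; apply: ab; rewrite -ia -jb E.
exists (fun l => quotient_pi (kernel g) (e (lift i l))) => t.
have [l lt] := esurj (quotient_repr t).
have [l' l'E] : exists l', g (e (lift i l')) = g (e l).
  case: (unliftP i l) => [l' ->|->]; first by exists l'.
  case: (unliftP i j) => [j' jE|E]; last by rewrite E eqxx in ij.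
  by exists j'; rewrite -jE ia jb.
exists l'; rewrite -[RHS]quotient_reprK -lt; apply/quotient_piP => //.
exact: kernel_congruence.
Qed.

Lemma finite_Qsubdirectly_irreducible_countermodel (q : quasi_identity L) A :
  Q A -> ~ qsatisfies A q ->
  exists S, [/\ finite_algebra S, Qsubdirectly_irreducible Q S & ~ qsatisfies S q].
Proof.
move=> QA /(finite_countermodel QA) [B [QB fB nB]].
pose P n := exists (S : algebra L) (e : 'I_n -> S),
  [/\ Q S, ~ qsatisfies S q & forall t, exists i, e i = t].
have exP : exists n, `[< P n >].
  by have [n [e eP]] := finite_enumeration fB; exists n; apply/asboolP; exists B, e.
have [n /asboolP [S [e [QS nS eP]]] nmin] := ex_minnP exP.
have fS : finite_algebra S by exact: enumeration_finite eP.
exists S; split=> //.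
have [h hq] : exists h : nat -> S,
    ~ (solves_all h (premises q) -> solves h (conclusion q)) by apply/existsNP.
have [hprem hconc] := (not_implyP _ _).1 hq.
(* The two sides of the failed conclusion generate the monolith: a homomorphism that is not
   injective has a kernel quotient with a shorter enumeration, where [q] holds by minimality, so it
   identifies these two sides. *)
apply: (monolith_Qsubdirectly_irreducible QS hconc) => a b ab D g QD gh gab.
case: n e eP nmin => [|n] e eP nmin; first by have [[]] := eP a.
have [e' e'P] := noninjective_quotient_enumeration eP gh ab gab.
have [ct Qt] := kernel_Qcongruence QD gh.
have sat : qsatisfies (quotient (kernel g)) q.
  apply: contrapT => nsat; suff : (n.+1 <= n)%N by rewrite ltnn.
  by apply: nmin; apply/asboolP; exists (quotient (kernel g)), e'.
have pih := quotient_pi_hom ct.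
have := sat _ (solves_all_hom pih hprem).
by rewrite /solves !eval_hom // => /quotient_piP; apply.
Qed.

End Quasivariety.

(** * Diagrams of finite algebras *)

Lemma finite_diagram (L : signature) (S : algebra L) :
  finite_set [set: symb L] -> finite_algebra S ->
  exists (phi : seq (equation L nat)) (e : nat -> S) (idx : S -> nat),
    [/\ cancel idx e, solves_all e phi &
        forall (A : algebra L) (h : nat -> A), solves_all h phi -> is_hom (h \o idx)].
Proof.
move=> /finite_enumeration [m [sy syP]] /finite_enumeration [n [e eP]].
have [s0] := algebra_inhabited S.
have [i0 _] := eP s0.
case: n e eP i0 => [|n] e eP _; first by have [[]] := eP s0.
have [idx idxP] := choice eP.
(* Variable [i] names [e i]; [inord] sends the variables above [n], which do not occur in the
   diagram, to index 0. *)
have idxK : cancel (fun s => idx s : nat) (e \o inord) by move=> s /=; rewrite inord_val.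
pose eqn (f : symb L) (t : {ffun 'I_(arity f) -> 'I_n.+1}) : equation L nat :=
  (App f (fun i => Var (t i : nat)), Var (idx (op S f (fun i => e (t i))) : nat)).
exists (flatten [seq [seq eqn (sy j) t | t <- enum {: {ffun 'I_(arity (sy j)) -> 'I_n.+1}}]
                | j <- enum 'I_m]), (e \o inord), (fun s => idx s : nat).
split=> [//||A h /solves_all_flatten hphi f xs].
  apply/solves_all_flatten => j _; apply/solves_all_map => t _.
  rewrite /solves /= inord_val idxP; congr op.
  by apply/funext => i; rewrite inord_val.
have [j fE] := syP f; move: xs; rewrite -fE => xs.
have /solves_all_map /(_ [ffun i => idx (xs i)]) := hphi j (mem_enum _ _).
rewrite mem_enum => /(_ isT); rewrite /solves /= => hE.
rewrite (_ : xs = (fun i => e ([ffun i => idx (xs i)] i))).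
  rewrite /= -hE; congr op; apply/funext => i.
  by rewrite !ffunE idxP.
by apply/funext => i; rewrite ffunE idxP.
Qed.

Lemma separating_hom (L : signature) (Q : algebra L -> Prop) (F S : algebra L)
    (k0 : S -> F) (c d : S) :
  finite_set [set: symb L] -> almost_structurally_complete Q F ->
  finite_algebra S -> Q S -> is_hom k0 -> c <> d ->
  exists2 k : S -> F, is_hom k & k c <> k d.
Proof.
move=> fL asc fS QS k0h cd.
have [phi [e [idx [idxK ephi diag]]]] := finite_diagram fL fS.
pose q := QuasiIdentity phi (Var (idx c), Var (idx d)).
apply: contrapT => nex; apply: cd.
(* [k0] solves the diagram in [F], and a refutation of [q] in [F] would be a homomorphism separating
   [c] and [d]. *)
have act : active F q.
  split=> [h hphi|star]; last exact: star _ (solves_all_hom k0h ephi).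
  apply: contrapT => ncd; apply: nex; exists (h \o idx) => //.
  exact: diag.
have := asc q act S QS e ephi.
by rewrite /solves /= !idxK.
Qed.

(** * Almost structural completeness through embeddings *)

Theorem theorem6p1 (L : signature) (Q : algebra L -> Prop)
    (F : algebra L) (x : nat -> F) (C : set F) (hC : subuniverse C) :
  finite_set [set: symb L] ->
  quasivariety Q ->
  finite_model_property Q ->
  has_EDPRC Q ->
  free_algebra Q x ->
  finite_algebra (subalgebra hC) ->
  Qsimple Q (subalgebra hC) ->
  (almost_structurally_complete Q F <->
   forall S : algebra L, finite_algebra S -> Qsubdirectly_irreducible Q S ->
     embeds S F \/ embeds (prod_algebra S (subalgebra hC)) F).
Proof.
move=> fL HQ HFMP HE [QF Ffree] fC simpleC.
have QC : Q (subalgebra hC).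
  apply: (injective_mem HQ QF (@sval_hom L F C hC)) => u v.
  by apply: eq_sig_hprop => a; exact: Prop_irrelevance.
have [c0] := algebra_inhabited (subalgebra hC).
split=> [asc S fS Ssi|emb q [Fq Fstar] A QA].
  have [_ QS _] := Ssi.
  have [c [d [cd mono]]] := Qsubdirectly_irreducible_monolith HQ Ssi.
  have [[k0 k0h]|nohom] := pselect (exists k : S -> F, is_hom k).
    left; have [k kh kcd] := separating_hom fL asc fS QS k0h cd.
    exists k; split=> // a b kab; apply: contrapT => nab.
    by apply: kcd; exact: (mono a b).
  right; set SC := prod_algebra S (subalgebra hC).
  have fSC : finite_algebra SC.
    by rewrite /finite_algebra /= -setXTT; exact: finite_setX.
  have QSC : Q SC by exact: prod_mem.
  have k0h : @is_hom L SC F (sval \o snd) by [].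
  have ncd : (c, c0) <> (d, c0) :> SC by case.
  have [k kh kcd] := separating_hom fL asc fSC QSC k0h ncd.
  exists k; split=> // -[s u] [s' u'] kE.
  (* If [u] and [u'] differ, simplicity of [C] makes this pair force everything in the second
     coordinate. Then [k] ignores whether that coordinate is [c0] or the result of an operation on
     copies of [c0], so [k (t, c0)] is a homomorphism in [t], against [nohom]. *)
  have [uE|nu] := pselect (u = u'); last first.
    case: nohom; exists (fun t => k (t, c0)) => f xs.
    apply: etrans (kh f (fun i => (xs i, c0))).
    suff H : @forces L Q SC (s, u) (s', u') (op S f xs, c0) (op SC f (fun i => (xs i, c0))).
      exact: (H F k QF kh kE).
    by apply: (forces_prod HQ HE) => //; exact: Qsimple_forces.
  have [sE|ns] := pselect (s = s'); first by rewrite uE sE.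
  (* With equal second coordinates, [(s, s')] forces the monolith pair of [S], which [k]
     separates. *)
  case: kcd; suff H : @forces L Q SC (s, u) (s', u') (c, c0) (d, c0).
    exact: (H F k QF kh kE).
  by apply: (forces_prod HQ HE) => //; exact: mono.
apply: contrapT => nA.
have [S [fS Ssi nS]] := finite_Qsubdirectly_irreducible_countermodel HQ HE HFMP QA nA.
apply: nS => h hprem.
have [[k [kh kinj]]|[k [kh kinj]]] := emb S fS Ssi.
  apply: (solves_injective_hom kh kinj); apply: Fq.
  exact: solves_all_hom.
(* Freeness supplies a homomorphism from [F] to [C]; it moves a solution of the premises, which
   exists in [F] by activity, into [C], to be paired with [h]. *)
have [l [lh _]] : exists l : F -> subalgebra hC, is_hom l /\ forall n, l (x n) = c0.
  by have [l [? _]] := Ffree (subalgebra hC) (fun=> c0) QC; exists l.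
have [w wprem] : exists w : nat -> F, solves_all w (premises q).
  by apply: contrapT => nw; apply: Fstar => w wprem; apply: nw; exists w.
pose hw : nat -> prod_algebra S (subalgebra hC) := fun n => (h n, l (w n)).
have hwprem : solves_all hw (premises q).
  by apply: solves_all_prod => //; exact: (solves_all_hom lh wprem).
have /(solves_injective_hom kh kinj) := Fq _ (solves_all_hom kh hwprem).
exact: (@solves_hom L (prod_algebra S (subalgebra hC)) S fst nat hw).
Qed.
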